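(* Let $A, B$ be two algebras, let $n \geqslant 2$ be an integer, and let $h : A \to B$ be an $n$-Jordan homomorphism. Then $$\sum_{\sigma \in S_n} \left( h\Big(\prod_{i=1}^{n} x_{\sigma(i)}\Big) - \prod_{i=1}^{n} h(x_{\sigma(i)}) \right) = 0$$ for all $x_1, \dots, x_n \in A$, where $S_n$ is the set of permutations on $\{1, \dots, n\}$. Furthermore, if $A$ and $B$ are commutative, then $h$ is an $n$-homomorphism.
   Context: Let $A, B$ be two algebras and $n \geqslant 2$ an integer. A linear map $h : A \to B$ is called an $n$-Jordan homomorphism if $h(a^n) = h(a)^n$ for all $a \in A$. A linear map $h : A \to B$ is called an $n$-homomorphism if $h\big(\prod_{i=1}^n a_i\big) = \prod_{i=1}^n h(a_i)$ for all $a_1, \dots, a_n \in A$.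
   Formalization: The algebras are associative over an arbitrary field; the claim for commutative A and B additionally assumes that n! is nonzero in that field (automatic over the reals, the complexes and in characteristic 0), since it fails in characteristic at most n, for example n = 2 over the field with two elements. *)

(* Defs.v *)
From HB Require Import structures.
From mathcomp Require Import all_boot all_order all_fingroup all_algebra.

Set Implicit Arguments.
Unset Strict Implicit.
Unset Printing Implicit Defensive.

Import GRing.Theory.
Local Open Scope ring_scope.

(* Associative algebras that need not have a unit, unlike [algType]; the
   product is the semigroup product [*%g]. *)
HB.mixin Record Semigroup_Lmodule_isNonUnitalAlgebra (R : pzRingType) A
    of Semigroup A & GRing.Lmodule R A := {
  nuamulDl : left_distributive (@monoid.mul A) +%R;
  nuamulDr : right_distributive (@monoid.mul A) +%R;
  nuascalerAl : forall (k : R) (a b : A), k *: (a * b)%g = ((k *: a)%R * b)%g;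
  nuascalerAr : forall (k : R) (a b : A), k *: (a * b)%g = (a * (k *: b)%R)%g
}.

#[short(type="nonUnitalAlgType")]
HB.structure Definition NonUnitalAlgebra (R : pzRingType) :=
  { A of Semigroup_Lmodule_isNonUnitalAlgebra R A & Semigroup A
         & GRing.Lmodule R A }.

Section NonUnitalProducts.
Variables (R : pzRingType) (A : nonUnitalAlgType R).

(* The library's iterated products and powers start from a unit element. The
   values below for an empty product and for exponent 0 are arbitrary. *)
Definition nuprod_seq (s : seq A) : A :=
  if s is a :: s' then foldl (fun b c : A => (b * c)%g) a s' else 0.

Definition nuprod (n : nat) (x : 'I_n -> A) : A :=
  nuprod_seq [seq x i | i <- enum 'I_n].

Definition nuexp (a : A) (n : nat) : A := iterop n (@monoid.mul A) a a.

End NonUnitalProducts.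

Section NJordan.
Variables (R : pzRingType) (A B : nonUnitalAlgType R).

Definition n_Jordan_homomorphism (n : nat) (h : {linear A -> B}) : Prop :=
  forall a : A, h (nuexp a n) = nuexp (h a) n.

Definition n_homomorphism (n : nat) (h : {linear A -> B}) : Prop :=
  forall a : 'I_n -> A, h (nuprod a) = nuprod (fun i => h (a i)).

End NJordan.

(* Main.v *)
(* Polarization: over any ring, the sum over all permutations s of the products
   x_(s 1) ... x_(s n) equals the sum over S of (-1)^(n - #|S|) times the n-th
   power of the partial sum of the x_i for i in S, by inclusion-exclusion over
   the image of the index maps. The right-hand side involves only sums, signs
   and n-th powers, all preserved by h. In the commutative case the n! summands
   coincide, and n! is invertible. *)

Require Import Defs.
From HB Require Import structures.
From mathcomp Require Import all_boot all_order all_fingroup all_algebra.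

Set Implicit Arguments.
Unset Strict Implicit.
Unset Printing Implicit Defensive.

Import GRing.Theory.
Local Open Scope ring_scope.

Lemma prodr_factor0 (R : pzSemiRingType) (I : finType) (F : I -> R) (i : I) :
  F i = 0 -> \prod_j F j = 0.
Proof.
move=> Fi0; suff: forall s, i \in s -> \prod_(j <- s) F j = 0.
  by apply; apply: mem_index_enum.
elim=> // j s IHs; rewrite big_cons inE => /orP[/eqP<-|/IHs->].
  by rewrite Fi0 mul0r.
by rewrite mulr0.
Qed.

(* Both sides are [\prod_i (1 - (i \notin T)%:R)], expanded on the left. *)
Lemma sum_supersets_sign (R : pzRingType) (I : finType) (T : {set I}) :
  \sum_(S : {set I} | T \subset S) (-1) ^+ #|~: S| = (T == setT)%:R :> R.
Proof.
have -> : (T == setT)%:R = \prod_(i : I) (1 - (i \notin T)%:R) :> R.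
  case: eqP => [->|/eqP]; first by rewrite big1 // => i _; rewrite inE subr0.
  rewrite -subTset => /subsetPn[i _ iT].
  by rewrite (prodr_factor0 (i := i)) // iT subrr.
rewrite bigA_distr /= big_mkcond /=; apply: eq_bigr => S _.
have [TS|/subsetPn[i iT iS]] := boolP (T \subset S).
  rewrite -prodr_const [LHS]big_mkcond /=; apply: eq_bigr => i _.
  rewrite inE; case: (boolP (i \in S)) => //= iS.
  by rewrite (contra (subsetP TS i)).
by rewrite (prodr_factor0 (i := i)) // (negPf iS) iT oppr0.
Qed.

Lemma sum_perm_prod_polarization (R : pzRingType) (n : nat) (y : 'I_n -> R) :
  \sum_(s : 'S_n) \prod_i y (s i) =
  \sum_(S : {set 'I_n}) (-1) ^+ #|~: S| * (\sum_(i in S) y i) ^+ n.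
Proof.
pose F := {ffun 'I_n -> 'I_n}.
(* A self-map of a finite set is bijective exactly when it is surjective. Stating the condition
   through the image gives the indicator that [sum_supersets_sign] expands. *)
transitivity (\sum_(f : F) ([set f i | i : 'I_n] == setT)%:R * \prod_i y (f i)).
  rewrite (bigID (fun f : F => injectiveb f)) /= [X in _ + X]big1 ?addr0 => [|f].
    rewrite [RHS](reindex (@pval _)) /=; last first.
      (* The default [1%g] is never reached, since only injective maps are converted. *)
      pose in_Sn := insubd (1%g : 'S_n).
      by exists in_Sn => /= f Uf; first apply: val_inj; apply: insubdK.
    apply: eq_big => /= [s | s _]; first by rewrite (valP s).
    rewrite (_ : _ == _) ?mul1r; first by apply: eq_bigr => i _; rewrite pvalE.
    rewrite -subTset; apply/subsetP => i _; apply/imsetP.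
    by exists (s^-1%g i); rewrite // pvalE permKV.
  move=> /negP ninj; case: eqP => [fT|_]; last by rewrite mul0r.
  have /imset_injP f_inj : #|[set f i | i : 'I_n]| == #|'I_n| by rewrite fT cardsT.
  by case: ninj; apply/injectiveP => i j; apply: f_inj.
transitivity (\sum_(f : F) \sum_(S : {set 'I_n} | [set f i | i : 'I_n] \subset S)
    (-1) ^+ #|~: S| * \prod_i y (f i)).
  by apply: eq_bigr => f _; rewrite -sum_supersets_sign mulr_suml.
rewrite (exchange_big_dep xpredT) //=; apply: eq_bigr => S _.
rewrite -mulr_sumr; congr (_ * _).
(* With the exponent read as the cardinal of ['I_n], the power is a product over ['I_n];
   distributing it yields the maps with all values in [S]. *)
rewrite -[X in _ ^+ X]card_ord -prodr_const bigA_distr_big /=.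
apply: eq_bigl => f.
apply/subsetP/ffun_onP => [fS i|fS _ /imsetP[i _ ->]]; last exact: fS.
by rewrite fS // imset_f.
Qed.

Section Unitization.
Variables (R : comPzRingType) (A : nonUnitalAlgType R).

(* Adjoining a unit gives access to the big operators of the ring library; a
   pair [(k, a)] stands for [k + a]. *)
Definition unitization : Type := (R * A)%type.

HB.instance Definition _ := GRing.Zmodule.copy unitization (R * A)%type.

Definition unitization_mul (u v : unitization) : unitization :=
  (u.1 * v.1, u.1 *: v.2 + v.1 *: u.2 + (u.2 * v.2)%g).

Definition unitization_one : unitization := (1, 0).

Lemma nuamul0l (a : A) : (0 * a)%g = 0 :> A.
Proof. by rewrite -[X in (X * _)%g](scale0r 0) -nuascalerAl scale0r. Qed.

Lemma nuamul0r (a : A) : (a * 0)%g = 0 :> A.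
Proof. by rewrite -[X in (_ * X)%g](scale0r 0) -nuascalerAr scale0r. Qed.

Lemma unitization_mulA : associative unitization_mul.
Proof.
move=> [k a] [l b] [m c]; rewrite /unitization_mul /= mulrA.
congr (_, _); rewrite !scalerDr !nuamulDl !nuamulDr !scalerA.
rewrite -!nuascalerAl -!nuascalerAr mulgA (mulrC m k) (mulrC m l).
rewrite -!addrA; congr (_ + (_ + _)).
rewrite [LHS]addrCA; congr (_ + _).
by rewrite [RHS]addrCA; congr (_ + _); rewrite [RHS]addrCA.
Qed.

Lemma unitization_mul1l : left_id unitization_one unitization_mul.
Proof.
by move=> [k a]; rewrite /unitization_mul /= mul1r scale1r scaler0 nuamul0l !addr0.
Qed.

Lemma unitization_mul1r : right_id unitization_one unitization_mul.
Proof.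
by move=> [k a]; rewrite /unitization_mul /= mulr1 scale1r scaler0 nuamul0r add0r addr0.
Qed.

Lemma unitization_mulDl : left_distributive unitization_mul +%R.
Proof.
move=> [k a] [l b] [m c]; rewrite /unitization_mul /=; congr (_, _).
  by rewrite mulrDl.
by rewrite /= scalerDl scalerDr nuamulDl [RHS]addrACA; congr (_ + _); rewrite [RHS]addrACA.
Qed.

Lemma unitization_mulDr : right_distributive unitization_mul +%R.
Proof.
move=> [k a] [l b] [m c]; rewrite /unitization_mul /=; congr (_, _).
  by rewrite mulrDr.
by rewrite /= scalerDl scalerDr nuamulDr [RHS]addrACA; congr (_ + _); rewrite [RHS]addrACA.
Qed.

HB.instance Definition _ := GRing.Zmodule_isPzRing.Build unitization
  unitization_mulA unitization_mul1l unitization_mul1r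
  unitization_mulDl unitization_mulDr.

Definition to_unitization (a : A) : unitization := (0, a).

Lemma to_unitization_inj : injective to_unitization.
Proof. by move=> a b []. Qed.

Lemma to_unitization_zmod_morphism : zmod_morphism to_unitization.
Proof. by move=> a b; congr (_, _); rewrite /= subrr. Qed.

HB.instance Definition _ :=
  GRing.isZmodMorphism.Build A unitization to_unitization
    to_unitization_zmod_morphism.

Lemma to_unitizationM (a b : A) :
  to_unitization (a * b)%g = to_unitization a * to_unitization b.
Proof. by congr (_, _); rewrite /= ?mulr0 // !scale0r !add0r. Qed.

(** Positivity matters: an empty [nuprod] is 0, while the empty product in the unitization is 1. *)
Lemma to_unitization_nuprod (n : nat) (x : 'I_n -> A) : (0 < n)%N ->
  to_unitization (nuprod x) = \prod_(i < n) to_unitization (x i).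
Proof.
case: n x => // n x _; rewrite big_ord_recl /nuprod enum_ordSl /= -map_comp.
(* [foldl] associates to the left and the big operator to the right, so the induction keeps the
   accumulator [a] general. *)
have foldlE s a : to_unitization (foldl (fun b c : A => (b * c)%g) a s) =
    to_unitization a * \prod_(b <- s) to_unitization b.
  elim: s a => [|b s IHs] a /=; first by rewrite big_nil mulr1.
  by rewrite IHs to_unitizationM big_cons mulrA.
rewrite foldlE big_map; congr (_ * _).
by rewrite enumT [index_enum _]unlock.
Qed.

(** Exponent 0 is excluded because [nuexp a 0] is [a], not a unit. *)
Lemma to_unitization_nuexp (a : A) (n : nat) : (0 < n)%N ->
  to_unitization (nuexp a n) = to_unitization a ^+ n.
Proof.
case: n => // n _; elim: n => // n IHn.
by rewrite exprS -IHn -to_unitizationM.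
Qed.

Lemma unitization_mulC : (forall a b : A, commute a b) ->
  commutative (@GRing.mul unitization).
Proof.
move=> AC [k a] [l b]; congr (_, _); rewrite /= 1?mulrC //.
by rewrite [X in X + _ = _]addrC AC.
Qed.

Lemma nuprod_perm (n : nat) (x : 'I_n -> A) (s : 'S_n) :
  (forall a b : A, commute a b) -> nuprod (fun i => x (s i)) = nuprod x.
Proof.
move=> AC; case: n x s => [|n] x s; first by rewrite /nuprod enum_ord0.
(* Commutativity is a hypothesis on [A], so the commutative ring structure that permits reindexing
   is built locally. *)
pose U : comPzRingType := HB.pack unitization
  (GRing.PzRing_hasCommutativeMul.Build unitization (unitization_mulC AC)).
apply: to_unitization_inj; rewrite !to_unitization_nuprod //.
by symmetry; apply: (@reindex_inj U *%R 1 _ _ xpredT _ (@perm_inj _ s)).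
Qed.

(** Polarization in the unitization is pulled back along the injective embedding. The signs act as
    scalars, since [A] may contain no -1. *)
Lemma sum_perm_nuprod (n : nat) (x : 'I_n -> A) : (0 < n)%N ->
  \sum_(s : 'S_n) nuprod (fun i => x (s i)) =
  \sum_(S : {set 'I_n}) (-1) ^+ #|~: S| *: nuexp (\sum_(i in S) x i) n.
Proof.
move=> n_gt0; apply: to_unitization_inj; rewrite !raddf_sum /=.
under eq_bigr do rewrite to_unitization_nuprod //.
rewrite (sum_perm_prod_polarization (fun i => to_unitization (x i))).
apply: eq_bigr => S _; rewrite -raddf_sum -to_unitization_nuexp //.
(* The embedding is used only as an additive map, so the sign is reduced to its parity: identity or
   opposite. *)
rewrite -signr_odd -[in RHS]signr_odd; case: odd; last by rewrite mul1r scale1r.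
by rewrite mulN1r scaleN1r raddfN.
Qed.

End Unitization.

Theorem theorem2p1 (F : fieldType) (A B : nonUnitalAlgType F) (n : nat)
    (n_ge2 : (2 <= n)%N) (h : {linear A -> B})
    (h_Jordan : n_Jordan_homomorphism n h) :
  (forall x : 'I_n -> A,
     \sum_(sigma : 'S_n)
       (h (nuprod (fun i => x (sigma i)))
        - nuprod (fun i => h (x (sigma i)))) = 0)
  /\ (n`!%:R != 0 :> F ->
      (forall a b : A, commute a b) -> (forall a b : B, commute a b) ->
      n_homomorphism n h).
Proof.
have n_gt0 : (0 < n)%N by apply: ltnW.
have sum0 (x : 'I_n -> A) :
    \sum_(sigma : 'S_n) (h (nuprod (fun i => x (sigma i)))
        - nuprod (fun i => h (x (sigma i)))) = 0.
  rewrite sumrB -raddf_sum sum_perm_nuprod //.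
  rewrite (sum_perm_nuprod (fun i => h (x i))) // raddf_sum.
  apply/eqP; rewrite subr_eq0; apply/eqP/eq_bigr => S _.
  (* For each [S], the Jordan hypothesis is applied to the partial sum of the [x i] with [i] in
     [S]. *)
  by rewrite raddfZsign /= h_Jordan raddf_sum.
split=> // nfact_neq0 AC BC a; apply/eqP; rewrite -subr_eq0.
have := sum0 a.
under eq_bigr do rewrite nuprod_perm // (nuprod_perm (fun i => h (a i))) //.
(* The constant sum is the difference scaled by [n!] as an element of [F], so one of the two factors
   vanishes. *)
rewrite sumr_const card_Sn -scaler_nat => /eqP.
by rewrite scaler_eq0 (negPf nfact_neq0).
Qed.
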